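(* A finite semigroup is inherently nondualisable if it has index more than $2$.
   Context: The index of a finite semigroup $\mathbf{S}$ is the smallest positive integer $i$ such that $\mathbf{S}$ satisfies the law $x^{i}\approx x^{i+p}$ for some positive integer $p$. Semigroups are algebras with a single binary operation. Duality notions. Let $\mathbf{M}$ be a finite algebra and $\mathcal{Q}=\mathsf{ISP}(\mathbf{M})$ the quasivariety it generates (isomorphic copies of subalgebras of direct powers of $\mathbf{M}$). An alter ego $\mathbb{M}$ of $\mathbf{M}$ is a structure on the same universe $M$, carrying the discrete topology and some finitary operations, partial operations and relations, such that each $n$-ary operation is a homomorphism $\mathbf{M}^n\to\mathbf{M}$, each $n$-ary relation is a subalgebra of $\mathbf{M}^n$, and each $n$-ary partial operation is a homomorphism from a subalgebra of $\mathbf{M}^n$ into $\mathbf{M}$. Let $\mathcal{X}=\mathsf{IS_cP^+}(\mathbb{M})$ be the class of topologically and algebraically isomorphic copies of closed substructures of powers of $\mathbb{M}$ over nonempty index sets (product topology, pointwise structure). For $\mathbf{A}\in\mathcal{Q}$, $D(\mathbf{A})=\hom(\mathbf{A},\mathbf{M})$, a closed substructure of $\mathbb{M}^A$; for $\mathbb{A}\in\mathcal{X}$, $E(\mathbb{A})$ is the algebra of continuous homomorphisms (structure-preserving maps) $\mathbb{A}\to\mathbb{M}$, a subalgebra of $\mathbf{M}^{\mathbb{A}}$. $\mathbb{M}$ yields a duality on $\mathbf{A}$ if the (always injective) evaluation homomorphism $e:\mathbf{A}\to E(D(\mathbf{A}))$, $e_a(x)=x(a)$, is an isomorphism. $\mathbf{M}$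 is dualisable (admits a natural duality) if some alter ego of $\mathbf{M}$ yields a duality on every $\mathbf{A}\in\mathcal{Q}$; otherwise it is nondualisable. A finite algebra $\mathbf{M}$ is inherently nondualisable if $\mathbf{M}\notin\mathsf{ISP}(\mathbf{N})$ for every finite dualisable algebra $\mathbf{N}$. *)

(* Defs.v *)
From HB Require Import structures.
From mathcomp Require Import all_boot.
From mathcomp Require Import all_classical topology.

Set Implicit Arguments.
Unset Strict Implicit.
Unset Printing Implicit Defensive.

Local Open Scope classical_set_scope.

Record signature := Signature { symbol : Type; arity : symbol -> nat }.

(* n-tuples are functions on 'I_n; universes of algebras are nonempty. *)
Record algebra (sg : signature) := Algebra {
  carrier :> Type;
  interp : forall f : symbol sg, ('I_(arity f) -> carrier) -> carrier;
  carrier_inhabited : inhabited carrier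
}.

Section UniversalAlgebra.
Context {sg : signature}.
Implicit Types A B M : algebra sg.

Definition is_hom A B (h : A -> B) : Prop :=
  forall (f : symbol sg) (a : 'I_(arity f) -> A),
    h (interp a) = interp (fun k => h (a k)).

Definition isomorphic A B : Prop :=
  exists h : A -> B, is_hom h /\ bijective h.

Lemma power_inhabited M (I : Type) : inhabited (I -> M).
Proof. by case: (carrier_inhabited M) => m; split=> _; exact: m. Qed.

Definition power M (I : Type) : algebra sg :=
  @Algebra sg (I -> M)
    (fun f a i => interp (fun k : 'I_(arity f) => a k i))
    (power_inhabited M I).

Definition is_subalgebra A (U : set A) : Prop :=
  U !=set0 /\
  forall (f : symbol sg) (a : 'I_(arity f) -> A),
    (forall k, U (a k)) -> U (interp a).

Lemma sub_inhabited A (U : set A) : is_subalgebra U -> inhabited U.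
Proof. by case=> -[x Ux] _; split; exists x; exact: mem_set. Qed.

Lemma sub_interp A (U : set A) (hU : is_subalgebra U)
  (f : symbol sg) (a : 'I_(arity f) -> U) :
  interp (fun k => set_val (a k)) \in U.
Proof. by apply/mem_set/(proj2 hU) => k; exact/set_mem/(valP (a k)). Qed.

Definition subalgebra A (U : set A) (hU : is_subalgebra U) : algebra sg :=
  @Algebra sg U
    (fun f a => exist _ (interp (fun k => set_val (a k))) (sub_interp hU a))
    (sub_inhabited hU).

Definition in_ISP M A : Prop :=
  exists (I : Type) (U : set (power M I)) (hU : is_subalgebra U),
    isomorphic A (subalgebra hU).

Record partial_op M (n : nat) := PartialOp {
  dom : set (power M 'I_n);
  dom_subalgebra : is_subalgebra dom;
  pop : subalgebra dom_subalgebra -> M;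
  pop_hom : is_hom pop
}.

Definition pop_graph M n (h : partial_op M n) (x : 'I_n -> M) (y : M) : Prop :=
  exists d : dom h, set_val d = x /\ @pop M n h d = y.

Record alter_ego M := AlterEgo {
  ops : forall n, set (('I_n -> M) -> M);
  pops : forall n, set (partial_op M n);
  rels : forall n, set (set ('I_n -> M));
  ops_hom : forall n (g : ('I_n -> M) -> M), ops g -> @is_hom (power M 'I_n) M g;
  rels_subalgebra : forall n (r : set ('I_n -> M)), rels r -> @is_subalgebra (power M 'I_n) r
}.

Definition discrete M : topologicalType := discrete_topology {classic M}.

(* Continuous structure-preserving maps into the alter ego from the
   substructure of its I-th power with underlying set X (subspace of the
   product topology, pointwise structure). *)
Definition continuous_morphism M (T : alter_ego M) (I : Type)
    (X : set {ptws I -> discrete M}) (alpha : X -> discrete M) : Prop :=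
  [/\ continuous alpha,
      forall n (g : ('I_n -> M) -> M), ops T g ->
        forall (x : 'I_n -> X) (y : X),
          (forall i, set_val y i = g (fun k => set_val (x k) i)) ->
          alpha y = g (fun k => alpha (x k)),
      forall n (h : partial_op M n), pops T h ->
        forall (x : 'I_n -> X) (y : X),
          (forall i, pop_graph h (fun k => set_val (x k) i) (set_val y i)) ->
          pop_graph h (fun k => alpha (x k)) (alpha y)
    & forall n (r : set ('I_n -> M)), rels T r ->
        forall x : 'I_n -> X,
          (forall i, r (fun k => set_val (x k) i)) ->
          r (fun k => alpha (x k))].

Definition dual M A : set {ptws A -> discrete M} := [set x | @is_hom A M x].
Arguments dual : clear implicits.

Definition bidual M (T : alter_ego M) A : set (power M (dual M A)) :=
  [set alpha | continuous_morphism T alpha].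
Arguments bidual [M] T A.

Definition evaluation M A (a : A) : power M (dual M A) :=
  fun x => set_val x a.

Definition yields_duality M (T : alter_ego M) A : Prop :=
  [/\ is_hom (@evaluation M A), injective (@evaluation M A)
    & range (@evaluation M A) = bidual T A].

Definition dualisable M : Prop :=
  exists T : alter_ego M, forall A, in_ISP M A -> yields_duality T A.

Definition inherently_nondualisable M : Prop :=
  forall N : algebra sg,
    finite_set [set: N] -> dualisable N -> ~ in_ISP N M.

End UniversalAlgebra.

Arguments dual {sg} M A.
Arguments bidual {sg} [M] T A.

Definition binary : signature := @Signature unit (fun=> 2).

Definition semigroup_algebra (S : semigroupType) (S0 : inhabited S) :
    algebra binary :=
  @Algebra binary S (fun _ (a : 'I_2 -> S) => (a ord0 * a ord_max)%g) S0.

(* Only meaningful for 0 < n, as S need not have a unit. *)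
Definition power_of (S : semigroupType) (x : S) (n : nat) : S :=
  iterop n (@mul S) x x.

Definition periodic_from (S : semigroupType) (i : nat) : Prop :=
  exists2 p : nat, 0 < p & forall x : S, power_of x i = power_of x (i + p).

Definition is_index (S : semigroupType) (i : nat) : Prop :=
  [/\ 0 < i, periodic_from S i
    & forall j, 0 < j -> periodic_from S j -> i <= j].

(* Main.v *)
(* Pick x in S whose square differs from all its higher powers. In a power of S
   take, for each pair (p, q) of vertices, a generator that is x on the blocks
   containing that edge and a higher power of x elsewhere. The product of two
   edges that meet exactly in n depends only on n; call it a_n. Under a
   homomorphism to an algebra with N elements, at most N disjoint pairs (n, m)
   can separate a_n from a_m: if the edges (n, m) and (n', m') have the same
   image, multiplying them by (n, n') and by (n', m) gives
   a_n ~ a_n' ~ a_m. Hence a_n is constant up to a bounded number of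
   exceptions, and sending a homomorphism to that constant is a continuous
   morphism of the dual of the generated subalgebra. It would have to be
   evaluation at the pointwise limit of the a_n. That limit equals x^2 only on
   the block of all edges, so it is not in the subalgebra: it would be a product
   of two generators, and any two edges share a smaller block. *)
Require Import Defs.
From mathcomp Require Import all_boot.
From mathcomp Require Import all_classical topology.
From mathcomp Require Import zify.

Set Implicit Arguments.
Unset Strict Implicit.
Unset Printing Implicit Defensive.

Local Open Scope classical_set_scope.

(** * Ghost elements and nondualisability *)

Lemma fresh_nat (s : seq nat) : exists n, n \notin s.
Proof.
exists (\max_(k <- s) k).+1; apply/negP => ms.
by have := @leq_bigmax_seq _ s predT id _ ms isT; rewrite ltnn.
Qed.

Lemma in_ISP_embedding (sg : signature) (M A : algebra sg) (J : Type)
    (h : A -> power M J) :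
  is_hom h -> injective h -> in_ISP M A.
Proof.
move=> hom_h inj_h.
have hU : is_subalgebra (A := power M J) (range h).
  split; first by case: (carrier_inhabited A) => a; exists (h a), a.
  move=> f a ha; have /choice[b hb] k : exists b, h b = a k.
    by have [b _ <-] := ha k; exists b.
  by exists (interp b) => //; rewrite hom_h; congr interp; apply/funext.
exists J, (range h), hU.
pose h' a : subalgebra hU := exist _ (h a) (mem_set (imageT h a)).
exists h'; split=> [f a|]; first exact/val_inj/hom_h.
have inj_h' : injective h' by move=> a b [/inj_h].
have /choice[g gK] (u : subalgebra hU) : exists a, h' a = u.
  have [a _ ha] := set_mem (valP u); exists a; exact: val_inj.
by exists g => [a|u //]; apply: inj_h'; rewrite gK.
Qed.

(** Apart from continuity, each condition of [bidual] involves finitely many points of the dual, and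
    evaluations satisfy it. *)
Lemma locally_evaluation_morphism (sg : signature) (N A : algebra sg)
    (T : alter_ego N) (alpha : dual N A -> discrete N) :
  continuous alpha ->
  (forall n (x : 'I_n -> dual N A) (y : dual N A), exists a : A,
     (forall k, alpha (x k) = set_val (x k) a) /\ alpha y = set_val y a) ->
  bidual T A alpha.
Proof.
move=> cont loc; split=> // [n g _ x y xy|n h _ x y xy|n r _ x rx].
- have [a [ax ->]] := loc n x y.
  by rewrite (xy a); congr g; apply/funext => k.
- have [a [ax ->]] := loc n x y.
  by rewrite (_ : (fun k => _) = fun k => set_val (x k) a) //; apply/funext.
(* A nullary relation offers no point to pass as [y] to [loc]; any element of [A] serves for the
   empty tuple. *)
- case: n r x rx => [|n] r x rx.
    have [a] := carrier_inhabited A.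
    rewrite (_ : (fun k => _) = fun k => set_val (x k) a) //.
    by apply/funext => -[].
  have [a [ax _]] := loc n.+1 x (x ord0).
  by rewrite (_ : (fun k => _) = fun k => set_val (x k) a) //; apply/funext.
Qed.


Lemma evaluation_near (sg : signature) (N A : algebra sg) (x : dual N A)
    (a : A) :
  \forall x' \near x, (set_val x' : A -> N) a = (set_val x : A -> N) a.
Proof.
have cont : continuous (fun x' : dual N A =>
    (set_val x' : A -> N) a : discrete N).
  move=> y.
  have := @proj_continuous {classic A} (fun=> discrete N) a (set_val y).
  exact: cvg_comp (@initial_continuous _ _ set_val y).
exact: (cont x _ (discrete_set1 _)).
Qed.

(* y x is the majority value of x on the first 2b+1 terms of a, which makes y
   continuous; finitely many exceptional sets miss a common n, so y is locally
   evaluation at a term of a. *)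
Lemma ghost_element (sg : signature) (N A : algebra sg) (T : alter_ego N)
    (a : nat -> A) (b : nat) (y : dual N A -> N) (t : dual N A -> seq nat) :
  (forall x, size (t x) <= b) ->
  (forall x n, n \notin t x -> set_val x (a n) = y x) ->
  bidual T A y.
Proof.
move=> tb yP; apply: locally_evaluation_morphism.
  move=> x P /nbhs_singleton Px.
  have nbhs_x : Filter (nbhs x) by exact: nbhs_filter.
  have : \forall x' \near x, forall n : 'I_(b + b).+1,
      (set_val x' : A -> N) (a n) = (set_val x : A -> N) (a n).
    pose near_n (n : 'I_(b + b).+1) : set (dual N A) :=
      [set x' | (set_val x' : A -> N) (a n) = (set_val x : A -> N) (a n)].
    by apply: (@filter_forall _ _ near_n (nbhs x)) => n; exact: evaluation_near.
  apply: filterS => x' xx'; suff e : y x' = y x by move: Px; rewrite -e.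
  have /allPn[n] : ~~ all (mem (t x ++ t x')) (iota 0 (b + b).+1).
    apply/negP => /allP /(uniq_leq_size (iota_uniq _ _)).
    by rewrite size_iota size_cat ltnNge leq_add.
  rewrite mem_iota /= mem_cat negb_or => nb /andP[nx nx'].
  by rewrite -(yP _ _ nx) -(yP _ _ nx') (xx' (Ordinal nb)).
move=> n x z; pose s := t z ++ flatten [seq t (x k) | k <- enum 'I_n].
have [m] := fresh_nat s.
rewrite mem_cat negb_or => /andP[mz /flatten_mapP mx].
exists (a m); split=> [k|]; rewrite yP //.
by apply/negP => mk; apply: mx; exists k; rewrite ?mem_enum.
Qed.

(** The value shared by almost all [h (a n)] defines an element of the bidual. If it were evaluation
    at some [u], the coordinate homomorphisms would force [u] to be [g]. *)
Lemma inherently_nondualisable_ghost (sg : signature) (M : algebra sg)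
    (I : Type) (U : set (power M I)) (hU : is_subalgebra U)
    (a : nat -> subalgebra hU) (g : I -> M) :
  (forall N : algebra sg, finite_set [set: N] ->
     exists b, forall h : subalgebra hU -> N, is_hom h ->
       exists y (t : seq nat), size t <= b /\
         forall n, n \notin t -> h (a n) = y) ->
  (forall (i : I) (t : seq nat),
     exists2 n, n \notin t & (set_val (a n) : I -> M) i = g i) ->
  ~ U g -> inherently_nondualisable M.
Proof.
move=> const_a g_lim gU N finN [T dualT] [J [V [hV [phi [hom_phi bij_phi]]]]].
set A := subalgebra hU in a const_a g_lim *.
have [b {}const_a] := const_a N finN.
pose e (u : A) (ij : I * J) : N :=
  (set_val (phi ((set_val u : I -> M) ij.1)) : J -> N) ij.2.
have hom_e (i : I) (j : J) : is_hom (fun u : A => e u (i, j)).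
  move=> f u; rewrite /e /=.
  have := hom_phi f (fun k => (set_val (u k) : I -> M) i).
  by move=> /(congr1 set_val)/(congr1 (fun v : J -> N => v j)).
have inj_phi : injective (fun m : M => set_val (phi m) : J -> N).
  by move=> m m' /val_inj; exact: bij_inj.
have [_ _ eval_onto] : yields_duality T A.
  apply/dualT/(@in_ISP_embedding _ _ _ _ e).
    by move=> f u; apply/funext => -[i j]; exact: hom_e.
  move=> u v uv; apply/val_inj/funext => i; apply: inj_phi; apply/funext => j.
  exact: (congr1 (fun w : I * J -> N => w (i, j)) uv).
have /choice[y /choice[t ytP]] (x : dual N A) : exists y (t : seq nat),
    size t <= b /\ forall n, n \notin t -> (set_val x : A -> N) (a n) = y.
  exact: const_a (set_mem (valP x)).
have : bidual T A y.
  by apply: (@ghost_element _ _ _ T a b y t) => x; have [] := ytP x.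
rewrite -eval_onto => -[u _ uy]; apply: gU.
suff <- : set_val u = g by exact/set_mem/(valP u).
apply/funext => i; apply: inj_phi; apply/funext => j.
pose x : dual N A := exist _ (fun v : A => e v (i, j)) (mem_set (hom_e i j)).
have [n nt <-] := g_lim i (t x).
have /= := (ytP x).2 n nt; rewrite -uy => en.
exact/esym/en.
Qed.

(** * Powers and the index *)

Lemma power_ofD (S : semigroupType) (x : S) (m n : nat) :
  0 < m -> 0 < n -> power_of x (m + n) = (power_of x m * power_of x n)%g.
Proof.
case: m n => [|m] [|n] // _ _; elim: m => [//|m IHm].
have powS k : power_of x k.+2 = (x * power_of x k.+1)%g by [].
by rewrite powS -mulgA -IHm addSn.
Qed.

Lemma power_of_period (S : semigroupType) (x : S) (i p n k : nat) :
  0 < i -> power_of x i = power_of x (i + p) -> i <= n ->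
  power_of x (n + k * p) = power_of x n.
Proof.
move=> i0 ip in_; elim: k => [|k IHk]; first by rewrite addn0.
have step m : i <= m -> power_of x (m + p) = power_of x m.
  rewrite leq_eqVlt => /predU1P[<-|im]; first exact/esym.
  rewrite -(subnKC (ltnW im)) addnAC power_ofD ?addn_gt0 ?i0 ?subn_gt0 //.
  by rewrite -ip power_ofD // subn_gt0.
by rewrite mulSn addnCA addnC step // (leq_trans in_) ?leq_addr.
Qed.

Lemma index_gt2_witness (S : semigroupType) (i : nat) :
  is_index S i -> 2 < i ->
  exists (x : S) (w : nat),
    [/\ 0 < w, forall n, power_of x (n + w + w) = power_of x (n + w)
      & forall q, 0 < q -> power_of x 2 <> power_of x (2 + q)].
Proof.
move=> [i0 [p p0 ip] min_i] i2.
have [x x2] : exists x : S, power_of x 2 <> power_of x (2 + p).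
  apply: contrapT => /forallNP all2; have := min_i 2 isT.
  rewrite leqNgt i2 => /(_ _)/negP[]//; exists p => // x.
  exact: contrapT (all2 x).
(* This [w] is a multiple of the period and at least [i], so [n + w] lies in the periodic range. *)
exists x, (i * p); rewrite muln_gt0 i0; split=> [//|n|q q0 xq].
  apply: (power_of_period _ i0 (ip x)).
  by rewrite (leq_trans _ (leq_addl _ _)) // leq_pmulr.
(* If [q] were a period of [x] from exponent 2, a shift by [i * q] would move 2 and [2 + p] to where
   [p] is a period. *)
have iq m : 2 <= m -> power_of x (m + i * q) = power_of x m.
  exact: power_of_period.
apply: x2; rewrite -(iq 2) // -(iq (2 + p)) // addnAC.
have := power_of_period 1 i0 (ip x); rewrite mul1n => -> //.
by rewrite (leq_trans _ (leq_addl _ _)) // leq_pmulr.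
Qed.

(** * Edges and blocks *)

Definition incident (n : nat) (e : nat * nat) : bool :=
  (n == e.1) || (n == e.2).

(* The blocks of a linear space whose points are the pairs (p, q), seen as
   edges: the stars of vertices, and the pairs of disjoint edges, so that any
   two points lie on a common block; Whole is added to remember the degree of
   a product. *)
Inductive coordinate := Whole | Star of nat | Gap of nat * nat & nat * nat.

Definition block (c : coordinate) (e : nat * nat) : bool :=
  match c with
  | Whole => true
  | Star n => incident n e
  | Gap e1 e2 =>
      ~~ (incident e1.1 e2 || incident e1.2 e2) && ((e == e1) || (e == e2))
  end.

(** The blocks common to two distinct edges that meet exactly in [n]. *)
Definition star_coordinate (n : nat) (c : coordinate) : bool :=
  match c with Whole => true | Star m => m == n | Gap _ _ => false end.

Lemma block_meet (n : nat) (e f : nat * nat) (c : coordinate) :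
  e != f -> incident n e -> incident n f ->
  (forall k, incident k e -> incident k f -> k = n) ->
  block c e && block c f = star_coordinate n c.
Proof.
move=> ef ne nf uniq_n; case: c => [//|m|e1 e2] /=.
  by apply/andP/eqP => [[]|-> //]; exact: uniq_n.
apply/negP => /andP[/andP[gap12 e12] /andP[_ f12]].
have gap : ~~ (incident n e1 && incident n e2).
  apply/negP => /andP[/orP[] /eqP-> n2]; move: gap12; by rewrite n2 ?orbT.
move: e12 f12 ef gap => /orP[] /eqP <- /orP[] /eqP <-; rewrite ?eqxx ?ne ?nf //.
Qed.

Lemma block_cover (e f : nat * nat) :
  exists2 c, c <> Whole & block c e && block c f.
Proof.
have [/orP[ef|ef]|gap] := boolP (incident e.1 f || incident e.2 f).
- by exists (Star e.1) => //=; rewrite ef /incident eqxx.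
- by exists (Star e.2) => //=; rewrite ef /incident eqxx orbT.
- by exists (Gap e f) => //=; rewrite gap !eqxx orbT.
Qed.

(* Pairs (n, m) with c n != c m that are pairwise disjoint have distinct
   images under v, so a maximal family of them has at most |N| members, and c
   is constant outside it. *)
Lemma almost_constant (N : Type) : finite_set [set: N] ->
  exists b, forall (c : nat -> N) (v : nat * nat -> N),
    (forall n m n' m', uniq [:: n; m; n'; m'] ->
       v (n, m) = v (n', m') -> c n = c m) ->
    exists y (t : seq nat), size t <= b /\ forall n, n \notin t -> c n = y.
Proof.
move=> /(@finite_seqP {classic N})[r rP]; exists (2 * (size r).+1) => c v cv.
pose flat (s : seq (nat * nat)) := flatten [seq [:: e.1; e.2] | e <- s].
have size_flat s : size (flat s) = 2 * size s.
  by elim: s => //= e s IHs; rewrite mulnS -IHs.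
apply: contrapT => none.
have [s [ss us bad]] : exists s, [/\ size s = (size r).+1, uniq (flat s)
    & {in s, forall e, c e.1 <> c e.2}].
  suff : forall k, k <= (size r).+1 -> exists s, [/\ size s = k, uniq (flat s)
      & {in s, forall e, c e.1 <> c e.2}] by apply.
  elim=> [|k IHk] kr; first by exists [::].
  have [s [ss us bad]] := IHk (ltnW kr).
  have out_s n : exists2 m, m \notin flat s & c m <> c n.
    apply: contrapT => no_m; apply: none; exists (c n), (flat s); split.
      by rewrite size_flat ss leq_mul2l ltnW.
    by move=> m ms; apply: contrapT => cmn; apply: no_m; exists m.
  (* The 0 is arbitrary: it only yields a vertex [n] outside [flat s]. *)
  have [n ns _] := out_s 0; have [m ms cmn] := out_s n.
  exists ((n, m) :: s); split=> [||e].
  - by rewrite /= ss.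
  - rewrite /= inE negb_or ns ms us !andbT.
    by apply/eqP => nm; apply: cmn; rewrite nm.
  - by rewrite inE => /predU1P[-> /=|/bad //] nm; apply: cmn.
have : uniq ([seq v e | e <- s] : seq {classic N}).
  elim: s us bad {ss} => //= -[n m] s IHs /=.
  rewrite inE negb_or => /and3P[/andP[nm ns] ms us] bad.
  rewrite {}IHs ?andbT //; last by move=> e es; apply: bad; rewrite inE es orbT.
  apply/mapP => -[[n' m'] es vv].
  have in_flat k : incident k (n', m') -> k \in flat s.
    move=> kn; apply/flattenP; exists [:: n'; m']; last by rewrite !inE.
    by apply/mapP; exists (n', m').
  apply: (bad (n, m)); first by rewrite inE eqxx.
  apply: cv vv; have bad' : n' != m'.
    by apply/eqP => nm'; apply: (bad (n', m')); rewrite ?inE ?es ?orbT //= nm'.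
  have neq k k' : k \notin flat s -> incident k' (n', m') -> k != k'.
    by move=> ks k's; apply: contraNneq ks => ->; exact: in_flat.
  rewrite /= !inE !negb_or nm bad' !(neq n) ?(neq m) //;
    by rewrite /incident eqxx ?orbT.
move=> /(@uniq_leq_size {classic N} _ r); rewrite size_map ss ltnn.
have r_full (z : {classic N}) : z \in r.
  by have : [set: {classic N}] z by []; rewrite rP.
by move=> /(_ (fun z _ => r_full z)).
Qed.

(** * The subalgebra of edge products *)

(** The product of the generators at the edges of [s], each [x] on the blocks through its edge and
    [x^(1+w)] elsewhere, with repeated shifts by [w] collapsed to one. *)
Definition edge_product (S : semigroupType) (x : S) (w : nat)
    (s : seq (nat * nat)) (c : coordinate) : S :=
  power_of x (size s + (if all (block c) s then 0 else w)).

Lemma edge_productM (S : semigroupType) (x : S) (w : nat)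
    (s s' : seq (nat * nat)) (c : coordinate) :
  (forall n, power_of x (n + w + w) = power_of x (n + w)) ->
  0 < size s -> 0 < size s' ->
  edge_product x w (s ++ s') c
    = (edge_product x w s c * edge_product x w s' c)%g.
Proof.
move=> xw s0 s'0; rewrite /edge_product -power_ofD ?addn_gt0 ?s0 ?s'0 //.
rewrite size_cat all_cat addnACA.
by case: all; case: all => //=; rewrite ?addn0 // addnA xw.
Qed.

Theorem corollary5p5 (S : semigroupType) (S0 : inhabited S) (i : nat) :
  finite_set [set: S] -> is_index S i -> 2 < i ->
  inherently_nondualisable (semigroup_algebra S0).
Proof.
move=> _ idx i2; have [x [w [w0 xw x2]]] := index_gt2_witness idx i2.
set M := semigroup_algebra S0; pose prod_ := edge_product x w.
pose U : set (power M coordinate) :=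
  [set u | exists2 s, 0 < size s & u = prod_ s].
have hU : is_subalgebra U.
  split; first by exists (prod_ [:: (0, 0)]), [:: (0, 0)].
  move=> f u Uu; have [s s0 us] := Uu ord0; have [s' s'0 us'] := Uu ord_max.
  exists (s ++ s'); first by rewrite size_cat addn_gt0 s0.
  by apply/funext => c; rewrite /prod_ edge_productM // /= us us'.
have Uprod e s : U (prod_ (e :: s)) by exists (e :: s).
pose elt e s : subalgebra hU := exist _ (prod_ (e :: s)) (mem_set (Uprod e s)).
pose a n := elt (n, n.+1) [:: (n, n.+2)].
have a_block n c : block c (n, n.+1) && block c (n, n.+2) = star_coordinate n c.
  by apply: block_meet => [|||k]; rewrite ?xpair_eqE /incident /=; lia.
have aE n e f : e != f -> incident n e -> incident n f ->
    (forall k, incident k e -> incident k f -> k = n) -> a n = elt e [:: f].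
  move=> ef ne nf uniq_n; apply/val_inj/funext => c /=.
  rewrite /prod_ /edge_product /= !andbT a_block.
  by rewrite (block_meet _ ef ne nf uniq_n).
have elt_mul (N : algebra binary) (h : subalgebra hU -> N) e e' f :
    is_hom h -> h (elt e [::]) = h (elt e' [::]) ->
    h (elt e [:: f]) = h (elt e' [:: f]).
  move=> hom_h hee'.
  have eltM d : elt d [:: f] = @interp _ (subalgebra hU) tt
      (fun k => if k == ord0 then elt d [::] else elt f [::]).
    apply/val_inj/funext => c; rewrite /= /prod_.
    by rewrite -edge_productM.
  rewrite !eltM !hom_h; congr interp; apply/funext => k.
  by case: ifP.
apply: (@inherently_nondualisable_ghost _ M _ U hU a
          (fun c => power_of x (2 + (if c is Whole then 0 else w)))).
- move=> N /almost_constant[b bP]; exists b => h hom_h.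
  apply: (bP _ (fun e => h (elt e [::]))) => n m n' m' + hv.
  rewrite /= !inE !negb_or => /and4P[/and3P[nm nn' nm'] /andP[mn' mm'] n'm' _].
  have key l l' f : a l = elt (n, m) [:: f] -> a l' = elt (n', m') [:: f] ->
      h (a l) = h (a l').
    by move=> -> ->; exact: elt_mul.
  have -> : h (a n) = h (a n').
    by apply: (key _ _ (n, n')); apply: aE => [|||k];
      rewrite ?xpair_eqE /incident /=; lia.
  apply/esym; apply: (key _ _ (n', m)); apply: aE => [|||k];
    rewrite ?xpair_eqE /incident /=; lia.
- move=> c t.
  (* On [Star m] the sequence differs from its limit at most at [n = m], so [m] is avoided too. *)
  have [n n_fresh] := fresh_nat (if c is Star m then m :: t else t).
  exists n; first by case: c n_fresh => //= m; rewrite inE negb_or => /andP[].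
  rewrite -[LHS]/(prod_ [:: (n, n.+1); (n, n.+2)] c) /prod_ /edge_product /=.
  rewrite andbT a_block.
  by case: c n_fresh => //= m; rewrite inE negb_or eq_sym => /andP[/negPf->].
- move=> [s s0 gs].
  have gsE c := congr1 (fun u : coordinate -> S => u c) gs.
  (* At [Whole] the product is [x] to the size of [s]; size 1 would give [x = x^2], hence
     [x^2 = x^3]. *)
  have s2 : size s = 2.
    have := gsE Whole; rewrite /= /prod_ /edge_product /= all_predT !addn0.
    case: s s0 {gs gsE} => [//|e [|e' [|e'' s]]] //= _ xs.
      case: (x2 1 isT).
      exact/esym/(@power_of_period _ x 1 1 2 1 isT (esym xs) isT).
    by case: (x2 (size s).+1).
  case: s s2 gsE {s0 gs} => [|e [|f []]] //= _ gsE.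
  have [c cW cef] := block_cover e f.
  have := gsE c; rewrite /prod_ /edge_product /= andbT cef.
  by case: c cW {cef} => // [?|? ?] _; rewrite addn0; exact/nesym/x2.
Qed.
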